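(* Let $f$ be convex on $\mathcal{X}=\mathcal{X}_1\times\cdots\times\mathcal{X}_{N_b}$, let $\alpha=B/N_b$, fix $q\in(0,\alpha]$ and $\rho\in(0.5,1]$, and let $$\gamma_t=\frac{2}{q\,t^\rho+2},\qquad t\ge 0 .$$ Then the iterates $\{\mathbf{x}^t\}$ of the randomized block Frank-Wolfe algorithm with step sizes $\{\gamma_t\}$ satisfy, for all $t\ge 1$, $$\mathbb{E}\left[h(\mathbf{x}^t)\right]\le \frac{4(1-\alpha)h(\mathbf{x}^0)}{\left[q(t-1)^\rho+2\right]^2}+\frac{2t\,\bar C_f^{B}}{\left[q(t-1)^\rho+2\right]^2}$$ and $$g_t\le \frac{(2\rho+1)^{2\rho+1}(q\,t^\rho+2)}{\alpha q^2(2\rho)^{2\rho}}\cdot\frac{(t+1)\bar C_f^{B}+2(1-\alpha)h(\mathbf{x}^0)}{t^{2\rho+1}},$$ where $g_t:=\min_{k\in\{0,1,\ldots,t\}}\mathbb{E}[g(\mathbf{x}^k)]$.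
   Context: Setting. $N_b\ge 1$ is an integer, $\mathcal{N}_b=\{1,\ldots,N_b\}$, $B\in\{1,\ldots,N_b\}$, $\alpha:=B/N_b$. Vectors $\mathbf{x}\in\mathbb{R}^d$ are split into blocks $\mathbf{x}=(\mathbf{x}_1,\ldots,\mathbf{x}_{N_b})$. The feasible set is $\mathcal{X}=\mathcal{X}_1\times\cdots\times\mathcal{X}_{N_b}$, with each $\mathcal{X}_n$ nonempty, convex and compact. The objective $f$ is real-valued and differentiable on (an open set containing) $\mathcal{X}$; $\nabla_{\mathbf{x}_n}f$ denotes the partial gradient with respect to block $n$. The problem is to minimize $f$ over $\mathcal{X}$; $\mathbf{x}^*$ is a global minimizer of $f$ over $\mathcal{X}$, and $h(\mathbf{x}):=f(\mathbf{x})-f(\mathbf{x}^* )$. The duality gap is $g(\mathbf{x}):=\sup_{\mathbf{s}\in\mathcal{X}}(\mathbf{x}-\mathbf{s})^\top\nabla f(\mathbf{x})$ for $\mathbf{x}\in\mathcal{X}$. Convention: $0^\rho=0$. Randomized block Frank-Wolfe algorithm. Start from a (deterministic) $\mathbf{x}^0\in\mathcal{X}$. At iteration $t=0,1,\ldots$: draw $\mathcal{B}_t$ uniformly at random among all subsets of $\mathcal{N}_b$ with exactly $B$ elements, independently of previous draws; for each $n\in\mathcal{B}_t$ pick a minimizer $\mathbf{s}_n^t\in\arg\min_{\mathbf{s}_n\in\mathcal{X}_n}\langle \mathbf{s}_n,\nabla_{\mathbf{x}_n}f(\mathbf{x}^t)\rangle$ (ties broken arbitrarily, as a function of the draws $\mathcal{B}_0,\ldots,\mathcal{B}_t$);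 set $\mathbf{x}_n^{t+1}=(1-\gamma_t)\mathbf{x}_n^t+\gamma_t\mathbf{s}_n^t$ for $n\in\mathcal{B}_t$ and $\mathbf{x}_n^{t+1}=\mathbf{x}_n^t$ for $n\notin\mathcal{B}_t$. Expectations are over the random draws. Curvature. For $\mathcal{B}\subseteq\mathcal{N}_b$, $$C_f^{\mathcal{B}}:=\sup \frac{2}{\gamma^2}\Big(f(\mathbf{y})-f(\mathbf{x})-\sum_{n\in\mathcal{B}}\langle\mathbf{y}_n-\mathbf{x}_n,\nabla_{\mathbf{x}_n}f(\mathbf{x})\rangle\Big),$$ the supremum being over $\gamma\in(0,1]$, $\mathbf{x}\in\mathcal{X}$, $\mathbf{s}_n\in\mathcal{X}_n$ ($n\in\mathcal{B}$), where $\mathbf{y}_n=(1-\gamma)\mathbf{x}_n+\gamma\mathbf{s}_n$ for $n\in\mathcal{B}$ and $\mathbf{y}_n=\mathbf{x}_n$ otherwise. The expected set curvature is $\bar C_f^{B}:=\binom{N_b}{B}^{-1}\sum_{\mathcal{B}\subseteq\mathcal{N}_b,\,|\mathcal{B}|=B}C_f^{\mathcal{B}}$. It is assumed throughout that $C_f:=C_f^{\mathcal{N}_b}$ is finite (hence so are all $C_f^{\mathcal{B}}$ and $\bar C_f^{B}$). *)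

(* Defs.v *)
From HB Require Import structures.
From mathcomp Require Import all_boot all_order all_algebra.
From mathcomp Require Import all_classical all_reals all_analysis.

Set Implicit Arguments.
Unset Strict Implicit.
Unset Printing Implicit Defensive.
Import Order.TTheory GRing.Theory Num.Theory.
Import numFieldNormedType.Exports.

Local Open Scope classical_set_scope.
Local Open Scope ring_scope.

(* A vector with blocks of dimensions d 0, ..., d (Nb - 1) is a row vector of
   length \sum_n d n, and its n-th block is [submxrow x n]; the blocks are
   numbered from 0. *)

Definition dot (R : realType) (m : nat) (u v : 'rV[R]_m) : R :=
  (u *m v^T) 0 0.

Definition grad (R : realType) (m : nat) (f : 'rV[R]_m -> R) (x : 'rV[R]_m) :
    'rV[R]_m :=
  \row_j 'D_(delta_mx 0 j) (f : 'rV[R]_m -> R^o) x.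

Definition block_grad (R : realType) (Nb : nat) (d : 'I_Nb -> nat)
    (f : 'rV[R]_(\sum_n d n) -> R) (x : 'rV[R]_(\sum_n d n)) (n : 'I_Nb) :
    'rV[R]_(d n) :=
  submxrow (grad f x) n.

Definition feasible (R : realType) (Nb : nat) (d : 'I_Nb -> nat)
    (X : forall n, set 'rV[R]_(d n)) : set 'rV[R]_(\sum_n d n) :=
  [set x | forall n, X n (submxrow x n)].

Definition block_step (R : realType) (Nb : nat) (d : 'I_Nb -> nat)
    (A : {set 'I_Nb}) (gamma : R) (x : 'rV[R]_(\sum_n d n))
    (s : forall n, 'rV[R]_(d n)) : 'rV[R]_(\sum_n d n) :=
  \mxrow_n (if n \in A then (1 - gamma) *: submxrow x n + gamma *: s n
            else submxrow x n).

Definition duality_gap (R : realType) (Nb : nat) (d : 'I_Nb -> nat)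
    (f : 'rV[R]_(\sum_n d n) -> R) (X : forall n, set 'rV[R]_(d n))
    (x : 'rV[R]_(\sum_n d n)) : R :=
  sup [set dot (x - s) (grad f x) | s in feasible X].

Definition curvature_quotients (R : realType) (Nb : nat) (d : 'I_Nb -> nat)
    (f : 'rV[R]_(\sum_n d n) -> R) (X : forall n, set 'rV[R]_(d n))
    (A : {set 'I_Nb}) : set R :=
  [set c | exists gamma x (s : forall n, 'rV[R]_(d n)),
    [/\ 0 < gamma <= 1, feasible X x, forall n, n \in A -> X n (s n) &
      let y := block_step A gamma x s in
      c = 2 / gamma ^+ 2 *
          (f y - f x
           - \sum_(n in A) dot (submxrow y n - submxrow x n)
                               (block_grad f x n))]].

Definition set_curvature (R : realType) (Nb : nat) (d : 'I_Nb -> nat)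
    (f : 'rV[R]_(\sum_n d n) -> R) (X : forall n, set 'rV[R]_(d n))
    (A : {set 'I_Nb}) : \bar R :=
  ereal_sup [set c%:E | c in curvature_quotients f X A].

(* [fine] loses nothing as soon as the curvature of the full set of blocks is
   finite: taking s_n = x_n outside A shows that the curvature of A is then
   finite as well. *)
Definition expected_curvature (R : realType) (Nb : nat) (d : 'I_Nb -> nat)
    (f : 'rV[R]_(\sum_n d n) -> R) (X : forall n, set 'rV[R]_(d n))
    (B : nat) : R :=
  'C(Nb, B)%:R^-1 *
  \sum_(A : {set 'I_Nb} | #|A| == B) fine (set_curvature f X A).

(* The draws are random variables with values in the finite discrete space
   {set 'I_Nb}, whose subsets are all measurable. *)
Record independent_uniform_draws (R : realType) (dd : measure_display)
    (T : measurableType dd) (P : probability T R) (Nb B : nat)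
    (D : nat -> T -> {set 'I_Nb}) : Prop := {
  draws_measurable : forall t (E : set {set 'I_Nb}), measurable (D t @^-1` E);
  draws_uniform : forall t (A : {set 'I_Nb}),
    P (D t @^-1` [set A]) =
      (if #|A| == B then 'C(Nb, B)%:R^-1 else 0)%:E;
  draws_independent : forall (r : seq nat) (E : nat -> set {set 'I_Nb}),
    uniq r ->
    P (\bigcap_(t in [set` r]) (D t @^-1` E t)) =
      (\prod_(t <- r) P (D t @^-1` E t))%E
}.

(* [s t w n] is the minimizer picked for block n at iteration t; it is
   constrained only for the blocks n drawn at iteration t. *)
Record rbfw_iterates (R : realType) (T : Type) (Nb : nat) (d : 'I_Nb -> nat)
    (f : 'rV[R]_(\sum_n d n) -> R) (X : forall n, set 'rV[R]_(d n))
    (gamma : nat -> R) (D : nat -> T -> {set 'I_Nb})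
    (x0 : 'rV[R]_(\sum_n d n)) (s : nat -> T -> forall n, 'rV[R]_(d n))
    (x : nat -> T -> 'rV[R]_(\sum_n d n)) : Prop := {
  iterates_init : forall w, x 0%N w = x0;
  iterates_oracle : forall t w n, n \in D t w ->
    X n (s t w n) /\
    forall v, X n v ->
      dot (s t w n) (block_grad f (x t w) n) <= dot v (block_grad f (x t w) n);
  iterates_adapted : forall t,
    exists phi : seq {set 'I_Nb} -> forall n, 'rV[R]_(d n),
      forall w, s t w = phi (mkseq (fun k => D k w) t.+1);
  iterates_step : forall t w,
    x t.+1 w = block_step (D t w) (gamma t) (x t w) (s t w)
}.

(* Main.v *)
(** With [h = f - f xstar], [g_n] the duality gap of block [n] and [G] the sum of
    the [g_n], one step satisfies pointwise
      [h (x t.+1) + gamma t * \sum_(n in D t) g_n (x t)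
         <= h (x t) + gamma t ^+ 2 / 2 * C^(D t)],
    and [D t] is independent of [x t], so in expectation
      [E h (x t.+1) + alpha * gamma t * E G (x t)
         <= E h (x t) + gamma t ^+ 2 / 2 * Cbar].
    Write [a t = q * t `^ rho + 2 = 2 / gamma t].  Since [h <= G] by convexity, the
    first bound follows by induction from [(a t - q) ^+ 2 <= a t.-1 ^+ 2].  For the
    second one, summing the recursion from [j + 1] to [t] and inserting the first
    bound at [j + 1] bounds the least of the [E G (x k)] by
    [a t * ((t + 1) * Cbar + 2 * (1 - alpha) * h x0)
       / (alpha * (t - j) * a j ^+ 2)], and [j] is then optimized. *)
Require Import Defs.
From HB Require Import structures.
From mathcomp Require Import all_boot all_order all_algebra.
From mathcomp Require Import all_classical all_reals all_analysis.
From mathcomp Require Import measurable_realfun lra ring.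

Set Implicit Arguments.
Unset Strict Implicit.
Unset Printing Implicit Defensive.
Import Order.TTheory GRing.Theory Num.Theory.
Import numFieldNormedType.Exports.

Local Open Scope classical_set_scope.
Local Open Scope ring_scope.

(** * Real sequences obeying the descent recursion *)

Section Recursion.
Context {R : realFieldType}.
Variables (al q C : R) (a eh eg : nat -> R).
Hypotheses (hq : 0 < q <= al) (hal : al <= 1) (C_ge0 : 0 <= C).
Hypotheses (a0 : a 0%N = 2) (a_ge2 : forall t, 2 <= a t).
Hypothesis a_mono : forall t, a t <= a t.+1 <= a t + q.
Hypothesis eh_ge0 : forall t, 0 <= eh t.
Hypothesis eh_eg : forall t, eh t <= eg t.
Hypothesis rec : forall t,
  eh t.+1 + al * (2 / a t) * eg t <= eh t + (2 / a t) ^+ 2 / 2 * C.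

(** Multiplying the recursion by the squared [a] turns its noise term into the constant [2 * C], so
    the potential [eh t.+1 * a t ^+ 2] grows by at most [2 * C] per step. *)
Lemma recursion_primal_bound t :
  eh t.+1 <= (4 * (1 - al) * eh 0%N + 2 * t.+1%:R * C) / a t ^+ 2.
Proof.
elim: t => [|t IH].
  (* The first step size [2 / a 0] is 1, so [eh 1 <= (1 - al) * eh 0 + C / 2]; multiplying by
     [a 0 ^+ 2 = 4] gives the claim. *)
  have := rec 0; rewrite a0 divff // expr1n ler_pdivlMr ?exprn_gt0//.
  by have := eh_eg 0; have := eh_ge0 0; case/andP: hq; nra.
have at0 : 0 < a t by have := a_ge2 t; lra.
have as0 : 0 < a t.+1 by have := a_ge2 t.+1; lra.
rewrite ler_pdivlMr ?exprn_gt0//.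
rewrite ler_pdivlMr ?exprn_gt0// in IH.
set K := _ + 2 * t.+1%:R * C in IH.
have K0 : 0 <= K.
  by apply: addr_ge0; rewrite !mulr_ge0 ?subr_ge0//.
have step : eh t.+2 * a t.+1 ^+ 2
    <= eh t.+1 * (a t.+1 ^+ 2 - 2 * al * a t.+1) + 2 * C.
  have H := rec t.+1.
  have -> : eh t.+1 * (a t.+1 ^+ 2 - 2 * al * a t.+1) + 2 * C =
    (eh t.+1 + (2 / a t.+1) ^+ 2 / 2 * C - al * (2 / a t.+1) * eh t.+1)
      * a t.+1 ^+ 2 by field; rewrite gt_eqF.
  rewrite ler_wpM2r ?sqr_ge0// lerBrDr (le_trans _ H)// lerD2l.
  by rewrite ler_wpM2l// mulr_ge0 ?divr_ge0//; case/andP: hq; lra.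
(* Since [q <= al], the left side is at most [(a t.+1 - q) ^+ 2], and [0 <= a t.+1 - q <= a t]. *)
have sq : a t.+1 ^+ 2 - 2 * al * a t.+1 <= a t ^+ 2.
  by have /andP[] := a_mono t; have := a_ge2 t.+1; case/andP: hq; nra.
have -> : 4 * (1 - al) * eh 0 + 2 * t.+2%:R * C = K + 2 * C.
  by rewrite /K -[t.+2]addn1 natrD; ring.
by apply: (le_trans step); rewrite lerD2r (le_trans _ IH)// ler_wpM2l.
Qed.

Lemma a_homo : {homo a : i j / (i <= j)%N >-> i <= j}.
Proof. by apply: homo_leq => // [t u v|t]; [exact: le_trans|case/andP: (a_mono t)]. Qed.

(** Telescoping from [j.+1]; as [a] is nondecreasing, every noise term is at most its value at
    [j]. *)
Lemma recursion_sum j n :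
  eh (j + n).+1 + al * \sum_(i < n) (2 / a (j + i).+1) * eg (j + i).+1
    <= eh j.+1 + n%:R * (2 * C / a j ^+ 2).
Proof.
elim: n => [|n IH]; first by rewrite addn0 big_ord0 mulr0 mul0r.
rewrite big_ord_recr /= addnS mulrDr mulrA -natr1 mulrDl mul1r.
have H := rec (j + n).+1.
suff K : (2 / a (j + n).+1) ^+ 2 / 2 * C <= 2 * C / a j ^+ 2 by lra.
have aj0 : 0 < a j by have := a_ge2 j; lra.
have an0 : 0 < a (j + n).+1 by have := a_ge2 (j + n).+1; lra.
have -> : (2 / a (j + n).+1) ^+ 2 / 2 * C = 2 * C / a (j + n).+1 ^+ 2.
  by field; rewrite gt_eqF.
rewrite ler_wpM2l ?mulr_ge0// lef_pV2 ?posrE ?exprn_gt0//.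
by rewrite ler_sqr ?nnegrE ?(ltW aj0) ?(ltW an0)// a_homo// leqW// leq_addr.
Qed.

(** If all [eg k] with [k <= t] exceeded the bound, the weighted gaps from [j.+1] to [t] would use
    up more than [eh j.+1] plus the noise, forcing [eh t.+1 < 0]. *)
Lemma recursion_dual_bound j t : (j < t)%N ->
  exists2 k, (k <= t)%N & eg k <=
    a t * ((t%:R + 1) * C + 2 * (1 - al) * eh 0%N)
      / (al * (t%:R - j%:R) * a j ^+ 2).
Proof.
move=> jt; set b := _ / _; apply: contrapT => /forall2NP noK.
have lb k : (k <= t)%N -> b < eg k.
  by move=> kt; case: (noK k) => // /negP; rewrite -ltNge.
have al0 : 0 < al by case/andP: hq; lra.
have at0 : 0 < a t by have := a_ge2 t; lra.
have aj0 : 0 < a j by have := a_ge2 j; lra.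
have tj0 : 0 < (t%:R - j%:R : R) by rewrite subr_gt0 ltr_nat.
have := recursion_sum j (t - j); rewrite subnKC 1?ltnW// natrB 1?ltnW//.
apply/negP; rewrite -ltNge.
have primal := recursion_primal_bound j.
have : (t%:R - j%:R) * (2 / a t * b) <
    \sum_(i < t - j) 2 / a (j + i).+1 * eg (j + i).+1.
  have -> : (t%:R - j%:R) * (2 / a t * b) = \sum_(i < t - j) (2 / a t * b).
    by rewrite sumr_const card_ord -[RHS]mulr_natl natrB// ltnW.
  have lt (i : 'I_(t - j)) : 2 / a t * b < 2 / a (j + i).+1 * eg (j + i).+1.
    have it : ((j + i).+1 <= t)%N by rewrite -addnS -leq_subRL ?ltn_ord 1?ltnW.
    have ai0 : 0 < a (j + i).+1 by have := a_ge2 (j + i).+1; lra.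
    apply: (@lt_le_trans _ _ (2 / a t * eg (j + i).+1)).
      by rewrite ltr_pM2l ?divr_gt0// lb.
    rewrite ler_wpM2r ?(le_trans (eh_ge0 _) (eh_eg _))//.
    by rewrite ler_pM2l// lef_pV2 ?posrE// a_homo.
  apply: ltr_sum; last by move=> i _; exact: lt.
  (* A strict inequality between sums needs a nonempty range, which [j < t] provides. *)
  by apply/hasP; exists (Ordinal (etrans (subn_gt0 j t) jt)); rewrite ?mem_index_enum.
rewrite -(ltr_pM2l al0).
(* The [j + 1] multiples of [2 * C] from the primal bound and the [t - j] from the noise add up to
   [t + 1], which is how the numerator of [b] becomes free of [j]. *)
suff -> : al * ((t%:R - j%:R) * (2 / a t * b)) =
    (4 * (1 - al) * eh 0 + 2 * j.+1%:R * C) / a j ^+ 2 +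
    (t%:R - j%:R) * (2 * C / a j ^+ 2).
  by have := eh_ge0 t.+1; lra.
rewrite /b -[j.+1]addn1 natrD; field.
by rewrite !gt_eqF.
Qed.

End Recursion.

(** * Real powers and the choice of the averaging window *)

Section Power.
Context {R : realType}.

Lemma powRV (y r : R) : 0 <= y -> y^-1 `^ r = (y `^ r)^-1.
Proof. by move=> y0; rewrite -powR_inv1// -powRrM mulN1r powRN. Qed.

(** For [z] in [[0, 1]] and [rho <= 1] one has [z <= z ^ rho]; apply this to [x / (x + 1)] and
    [1 / (x + 1)], which sum to 1. *)
Lemma powR_add1_le (rho x : R) : 0 < rho <= 1 -> 0 <= x ->
  (x + 1) `^ rho <= x `^ rho + 1.
Proof.
move=> /andP[r0 r1] x0.
have s0 : 0 < x + 1 by lra.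
have H y : 0 <= y <= x + 1 -> y / (x + 1) * (x + 1) `^ rho <= y `^ rho.
  move=> /andP[y0 ys].
  rewrite -ler_pdivlMr ?powR_gt0//.
  have -> : y `^ rho / (x + 1) `^ rho = (y / (x + 1)) `^ rho.
    by rewrite powRM ?powRV ?invr_ge0 // ltW.
  have [->|yN0] := eqVneq y 0; first by rewrite mul0r powR0 ?gt_eqF.
  have y_gt0 : 0 < y by rewrite lt_def yN0.
  rewrite ger1_powR// divr_gt0//=.
  by rewrite ler_pdivrMr// mul1r.
have H1 : x / (x + 1) * (x + 1) `^ rho <= x `^ rho by apply: H; rewrite x0 lerDl ler01.
have H2 : 1 / (x + 1) * (x + 1) `^ rho <= 1 `^ rho by apply: H; rewrite ler01 lerDr x0.
rewrite powR1 in H2.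
have -> : (x + 1) `^ rho = x / (x + 1) * (x + 1) `^ rho + 1 / (x + 1) * (x + 1) `^ rho.
  by field; rewrite gt_eqF.
exact: lerD.
Qed.

(* The right-hand side is the maximum of [(t - u) * u `^ (2 * rho)], attained at
   [u = 2 * rho * t / (2 * rho + 1)]; rounding [u] down is absorbed by the
   constant 2 in the step size. *)
Lemma exists_averaging_start (q rho : R) (t : nat) :
  0 < q <= 1 -> 1 / 2 < rho <= 1 -> (0 < t)%N ->
  exists2 j : nat, (j < t)%N &
    q ^+ 2 * ((2 * rho) `^ (2 * rho) / (2 * rho + 1) `^ (2 * rho + 1)
      * t%:R `^ (2 * rho + 1)) <= (t%:R - j%:R) * (q * j%:R `^ rho + 2) ^+ 2.
Proof.
move=> /andP[q0 q1] /andP[r0 r1] t0.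
have t0R : 0 < (t%:R : R) by rewrite ltr0n.
set u : R := 2 * rho * t%:R / (2 * rho + 1).
have u0 : 0 < u by rewrite divr_gt0 ?mulr_gt0//; lra.
have ut : u < t%:R by rewrite ltr_pdivrMr; nra.
have /andP[ju uj] := truncn_itv (ltW u0).
exists (Num.truncn u); first by rewrite -(ltr_nat R) (le_lt_trans ju).
move: (Num.truncn u) ju uj => j ju uj.
have -> : (2 * rho) `^ (2 * rho) / (2 * rho + 1) `^ (2 * rho + 1)
    * t%:R `^ (2 * rho + 1) = (t%:R - u) * (u `^ rho) ^+ 2.
  have -> : (u `^ rho) ^+ 2 = u `^ (2 * rho).
    by rewrite -powR_mulrn ?powR_ge0// -powRrM mulrC.
  have p1 : 0 < 2 * rho + 1 by lra.
  rewrite /u !powRM ?mulr_ge0 ?invr_ge0 ?powR_ge0 1?ltW//; try lra.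
  rewrite powRV; last by rewrite ltW.
  have D (y : R) : 0 < y -> y `^ (2 * rho + 1) = y `^ (2 * rho) * y.
    move=> y0; rewrite powRD ?powRr1 1?ltW//.
    by rewrite gt_eqF// implybT.
  rewrite (D t%:R)// (D (2 * rho + 1))//.
  field.
  by rewrite !gt_eqF ?powR_gt0.
have le_a : q * u `^ rho <= q * j%:R `^ rho + 2.
  have H : u `^ rho <= j%:R `^ rho + 1.
    apply: le_trans (powR_add1_le _ _) => //; last by lra.
    by apply: ge0_ler_powR; rewrite ?nnegrE -?natr1 in uj *; lra.
  by nra.
rewrite mulrCA -exprMn; apply: ler_pM.
- by lra.
- exact: sqr_ge0.
- by lra.
- have qu0 : 0 <= q * u `^ rho by rewrite mulr_ge0 ?powR_ge0// ltW.
  by rewrite ler_sqr ?nnegrE// (le_trans qu0).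
Qed.

End Power.

(** * Linearity of expectation for nonnegative variables, without integrability *)

Section NonnegativeExpectation.
Local Open Scope ereal_scope.
Context {R : realType} {dd : measure_display} {T : measurableType dd}.
Variable P : probability T R.
Implicit Types X Y : T -> R.

Lemma ge0_expectationD X Y : measurable_fun setT X -> measurable_fun setT Y ->
  (forall w, 0 <= X w)%R -> (forall w, 0 <= Y w)%R ->
  'E_P[fun w => X w + Y w]%R = 'E_P[X] + 'E_P[Y].
Proof.
move=> mX mY X0 Y0; rewrite unlock -ge0_integralD//;
  by [exact/measurable_EFinP | move=> w _; rewrite lee_fin].
Qed.

Lemma ge0_expectationZl k X : (0 <= k)%R -> measurable_fun setT X ->
  (forall w, 0 <= X w)%R -> 'E_P[fun w => k * X w]%R = k%:E * 'E_P[X].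
Proof.
move=> k0 mX X0; rewrite unlock -ge0_integralZl_EFin//;
  by [exact/measurable_EFinP | move=> w _; rewrite lee_fin].
Qed.

Lemma ge0_expectation_sum (I : finType) (X : I -> T -> R) :
  (forall i, measurable_fun setT (X i)) -> (forall i w, 0 <= X i w)%R ->
  'E_P[fun w => \sum_i X i w]%R = \sum_i 'E_P[X i].
Proof.
move=> mX X0; rewrite unlock -ge0_integral_sum//.
  by apply: eq_integral => w _; rewrite sumEFin.
  by move=> i; exact/measurable_EFinP.
by move=> i w _; rewrite lee_fin.
Qed.

End NonnegativeExpectation.

(** * Independence of a draw from the earlier draws *)

Section Histories.
Local Open Scope ereal_scope.
Context {R : realType} {dd : measure_display} {T : measurableType dd}.
Variables (P : probability T R) (Om : finType) (D : nat -> T -> Om).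
Hypothesis D_measurable : forall t (E : set Om), measurable (D t @^-1` E).
Hypothesis D_independent : forall (r : seq nat) (E : nat -> set Om),
  uniq r -> P (\bigcap_(t in [set` r]) (D t @^-1` E t)) =
            \prod_(t <- r) P (D t @^-1` E t).

Definition history t w : seq Om := mkseq (fun k => D k w) t.

(** Stands for measurability with respect to the sigma-algebra generated by the draws of index below
    [t]; as [Om] is finite, factoring through the history expresses it directly. *)
Definition history_measurable t (X : T -> R) : Prop :=
  exists u : seq Om -> R, X = (fun w => u (history t w)).

(** Drives the inductions below: conditioning on the last draw trades a function of [t.+1] draws for
    finitely many functions of [t] draws. *)
Lemma history_splitE t (u : seq Om -> R) w :
  u (history t.+1 w) =
  (\sum_(A : Om) \1_(D t @^-1` [set A]) w * u (rcons (history t w) A))%R.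
Proof.
rewrite (bigD1 (D t w)) //= big1 ?addr0; last first.
  move=> A AD; rewrite indicE memNset ?mul0r//= => /esym/eqP.
  exact/negP.
by rewrite indicE mem_set// mul1r /history mkseqS.
Qed.

Lemma measurable_history t (X : T -> R) :
  history_measurable t X -> measurable_fun setT X.
Proof.
move=> [u ->]; elim: t u => [|t IH] u; first exact: (measurable_cst (u [::])).
rewrite (_ : (fun w => _) = (fun w => \sum_(A : Om)
    (\1_(D t @^-1` [set A]) \* (fun w => u (rcons (history t w) A))) w)%R).
  apply: measurable_sum => A; apply: measurable_funM.
    exact: measurable_indic.
  exact: (IH (fun l => u (rcons l A))).
by apply/funext => w; rewrite history_splitE.
Qed.

Let integral_history0 (u : seq Om -> R) :
  \int[P]_w (u (history 0 w))%:E = (u [::])%:E.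
Proof.
by have := expectation_cst P (u [::]); rewrite unlock.
Qed.

(** The shape of event to which [D_independent] applies. *)
Let cylinder (r : seq nat) (E : nat -> set Om) :=
  \bigcap_(t in [set` r]) (D t @^-1` E t).

Let cylinder_measurable r E : measurable (cylinder r E).
Proof. by apply: bigcap_measurableType => // k _; exact: D_measurable. Qed.

Let cylinder_cons t A r E : t \notin r ->
  cylinder (t :: r) (fun i => if i == t then [set A] else E i) =
  D t @^-1` [set A] `&` cylinder r E.
Proof.
move=> tr; apply/seteqP; split => w /=.
  move=> H; split; first by have := H t; rewrite /= mem_head eqxx; exact.
  move=> i /= ir; have := H i; rewrite /= in_cons ir orbT => /(_ erefl).
  by case: eqVneq => // it; rewrite -it ir in tr.
move=> [Hw Hr] i /=; rewrite in_cons; case: eqVneq => [->//|_] /= ir.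
exact: Hr.
Qed.

Let probability_cylinder_cons t A r E : t \notin r -> uniq r ->
  P (cylinder (t :: r) (fun i => if i == t then [set A] else E i)) =
  P (D t @^-1` [set A]) * P (cylinder r E).
Proof.
move=> tr ur; rewrite /cylinder !D_independent//= ?tr// big_cons eqxx.
congr (_ * _); apply: eq_big_seq => i ir.
by case: eqVneq => // it; rewrite -it ir in tr.
Qed.

Let integral_cylinder_split t (u : seq Om -> R) r E :
  (forall l, 0 <= u l)%R -> t \notin r ->
  \int[P]_w (\1_(cylinder r E) w * u (history t.+1 w))%:E =
  \sum_(A : Om) \int[P]_w
    (\1_(cylinder (t :: r) (fun i => if i == t then [set A] else E i)) w
     * u (rcons (history t w) A))%:E.
Proof.
move=> u0 tr; rewrite -ge0_integral_sum//.
- apply: eq_integral => w _; rewrite history_splitE mulr_sumr -sumEFin.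
  apply: eq_bigr => A _; rewrite cylinder_cons// indicI.
  by rewrite mulrA [in LHS](mulrC (\1__ w)).
- move=> A; apply/measurable_EFinP/measurable_funM.
    exact: measurable_indic.
  by apply: measurable_history; exists (fun l => u (rcons l A)).
- by move=> A w _; rewrite lee_fin mulr_ge0.
Qed.

(* Splitting on the value of [D t] turns an event about draws of index [> t] into
   events about draws of index [>= t], so the induction on [t] must be uniform in
   the event. *)
Let integral_cylinder t (u : seq Om -> R) r E :
  (forall l, 0 <= u l)%R -> uniq r -> {in r, forall i, (t <= i)%N} ->
  \int[P]_w (\1_(cylinder r E) w * u (history t w))%:E =
  P (cylinder r E) * \int[P]_w (u (history t w))%:E.
Proof.
elim: t u r E => [|t IH] u r E u0 ur rt.
  rewrite integral_history0 [RHS]muleC.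
  rewrite (eq_integral (fun w => (u [::])%:E * (\1_(cylinder r E) w)%:E)); last first.
    by move=> w _; rewrite mulrC EFinM.
  rewrite ge0_integralZl_EFin//; last exact/measurable_EFinP/measurable_indic.
  by rewrite integral_indic// setIT.
have tr : t \notin r by apply/negP => /rt; rewrite ltnn.
have step s F : uniq s -> {in s, forall i, (t < i)%N} ->
    \int[P]_w (\1_(cylinder s F) w * u (history t.+1 w))%:E =
    P (cylinder s F) * \sum_(A : Om) (P (D t @^-1` [set A]) *
       \int[P]_w (u (rcons (history t w) A))%:E).
  move=> us st; have ts : t \notin s by apply/negP => /st; rewrite ltnn.
  rewrite integral_cylinder_split// ge0_sume_distrr; last first.
    by move=> A _; rewrite mule_ge0// integral_ge0// => w _; rewrite lee_fin.
  apply: eq_bigr => A _; rewrite (IH (fun l => u (rcons l A)))//=; last first.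
  - by move=> i; rewrite in_cons => /predU1P[->//|/st/ltnW].
  - by rewrite ts.
  by rewrite probability_cylinder_cons// muleCA muleA.
rewrite (step r E)//; congr (_ * _).
(* For the empty list the cylinder is the whole space, so [step] identifies the remaining sum with
   the integral of [u (history t.+1 w)]. *)
have := step [::] E erefl (fun _ => _).
rewrite /cylinder set_nil bigcap_set0 probability_setT mul1e => <-//.
by apply: eq_integral => w _; rewrite indicT mul1r.
Qed.

(** The sign of [u] is known only on histories that occur; replacing [u] by its absolute value makes
    it nonnegative everywhere without changing [X]. *)
Let ge0_history t X : history_measurable t X -> (forall w, 0 <= X w)%R ->
  exists2 u : seq Om -> R, (forall l, 0 <= u l)%R &
     X = (fun w => u (history t w)).
Proof.
move=> [u uX] X0; exists (fun l => `|u l|%R) => [l|]; first exact: normr_ge0.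
by rewrite uX in X0 *; apply/funext => w; rewrite ger0_norm.
Qed.

Lemma expectation_draw_history t X (E : set Om) :
  history_measurable t X -> (forall w, 0 <= X w)%R ->
  'E_P[fun w => \1_(D t @^-1` E) w * X w]%R = P (D t @^-1` E) * 'E_P[X].
Proof.
move=> hX /(ge0_history hX)[u u0 ->]; rewrite unlock.
have cE : D t @^-1` E = cylinder [:: t] (fun=> E).
  by rewrite /cylinder set_cons1 bigcap_set1.
by rewrite cE integral_cylinder// => i; rewrite inE => /eqP ->.
Qed.

Lemma measurable_draw t (v : Om -> R) : measurable_fun setT (fun w => v (D t w)).
Proof.
(* The default of [nth] is never read: the history has length [t.+1]. *)
apply: (@measurable_history t.+1); exists (fun l => v (nth (D t point) l t)).
by apply/funext => w; rewrite nth_mkseq.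
Qed.

(** Expand [v (D t w)] over the values of the draw; each indicator is independent of [X], which sees
    only earlier draws. *)
Lemma expectation_draw_mul_history t (v : Om -> R) X :
  (forall A, 0 <= v A)%R ->
  history_measurable t X -> (forall w, 0 <= X w)%R ->
  'E_P[fun w => v (D t w) * X w]%R =
  (\sum_(A : Om) P (D t @^-1` [set A]) * (v A)%:E) * 'E_P[X].
Proof.
move=> v0 hX X0.
have mX A : measurable_fun setT (fun w => (\1_(D t @^-1` [set A]) w * X w)%:E).
  apply/measurable_EFinP/measurable_funM; first exact: measurable_indic.
  exact: measurable_history hX.
have EX0 : 0 <= 'E_P[X] by exact: expectation_ge0.
rewrite ge0_sume_distrl; last by move=> A _; rewrite mule_ge0// lee_fin.
transitivity (\int[P]_w
    \sum_(A : Om) (v A)%:E * (\1_(D t @^-1` [set A]) w * X w)%:E).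
  rewrite unlock; apply: eq_integral => w _.
  rewrite (bigD1 (D t w))//= big1 ?adde0.
    by rewrite indicE mem_set// mul1r EFinM.
  move=> A AD; rewrite indicE memNset ?mul0r ?mule0//= => /esym/eqP.
  exact/negP.
rewrite ge0_integral_sum//; first last.
- by move=> A w _; rewrite mule_ge0 ?lee_fin ?mulr_ge0.
- by move=> A; apply: measurable_funeM.
apply: eq_bigr => A _; rewrite ge0_integralZl_EFin//; last first.
  by move=> w _; rewrite lee_fin mulr_ge0.
rewrite [X in _ * X](_ : _ = P (D t @^-1` [set A]) * 'E_P[X]).
  by rewrite muleCA muleA.
by rewrite -(expectation_draw_history _ hX)// unlock.
Qed.

(** Finitely many draws from a finite set produce finitely many values, so no bound on [X] has to be
    assumed. *)
Lemma expectation_history_fin_num t X :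
  history_measurable t X -> (forall w, 0 <= X w)%R -> 'E_P[X] \is a fin_num.
Proof.
move=> hX /(ge0_history hX)[{hX} u u0 ->]; rewrite unlock.
elim: t u u0 => [|t IH] u u0.
  by rewrite integral_history0.
(* The indicator of the empty cylinder equals 1; it is inserted to make [integral_cylinder_split]
   applicable. *)
rewrite (eq_integral (fun w =>
    (\1_(cylinder [::] (fun=> setT)) w * u (history t.+1 w))%:E)); last first.
  by move=> w _; rewrite /cylinder set_nil bigcap_set0 indicT mul1r.
have step A : \int[P]_w
    (\1_(cylinder [:: t] (fun i => if i == t then [set A] else setT)) w
     * u (rcons (history t w) A))%:E \is a fin_num.
  rewrite (@integral_cylinder t (fun l => u (rcons l A)))//; last first.
    by move=> i; rewrite mem_seq1 => /eqP ->.
  apply: fin_numM; last exact: IH (fun l => u (rcons l A)) _.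
  exact: fin_num_measure.
rewrite integral_cylinder_split//.
by rewrite sum_fin_num; apply/allP => _ /mapP[A _ ->]; exact: step.
Qed.

End Histories.

(** * Gradient inequality, block gaps and curvature *)

Section Blocks.
Context {R : realType}.

Section Dot.
Context {m : nat}.
Implicit Types u v w : 'rV[R]_m.

Lemma dotE u v : dot u v = \sum_j u 0 j * v 0 j.
Proof. by rewrite /dot mxE; apply: eq_bigr => j _; rewrite mxE. Qed.

Lemma dotDl u v w : dot (u + v) w = dot u w + dot v w.
Proof. by rewrite /dot mulmxDl mxE. Qed.

Lemma dotZl a u w : dot (a *: u) w = a * dot u w.
Proof. by rewrite /dot -scalemxAl mxE. Qed.

Lemma dotBl u v w : dot (u - v) w = dot u w - dot v w.
Proof. by rewrite -scaleN1r dotDl dotZl mulN1r. Qed.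

Lemma dot0l w : dot 0 w = 0.
Proof. by rewrite /dot mul0mx mxE. Qed.

Lemma entry_le_norm u j : `|u 0 j| <= `|u|.
Proof.
rewrite [leRHS]/Num.Def.normr /= mx_normrE; apply/bigmax_geP; right => /=.
by exists (0, j).
Qed.

Lemma compact_dot_has_ubound (K : set 'rV[R]_m) u v : compact K ->
  has_ubound [set dot (u - s) v | s in K].
Proof.
move=> /compact_bounded[M [_ /(_ (M + 1)) bM]].
exists (\sum_j (`|u 0 j| + (M + 1)) * `|v 0 j|) => _ [s Ks <-].
have sM : `|s| <= M + 1 by apply: bM => //; rewrite ltrDl.
rewrite dotE; apply: ler_sum => j _; apply: le_trans (ler_norm _) _.
rewrite normrM ler_wpM2r// !mxE (le_trans (ler_normB _ _))// lerD2l.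
exact: le_trans (entry_le_norm _ _) sM.
Qed.

(** [grad] records only coordinate derivatives; linearity of the differential makes them determine
    every directional derivative. *)
Lemma derive_dot_grad (f : 'rV[R]_m -> R) x v :
  differentiable (f : 'rV[R]_m -> R^o) x ->
  'D_v (f : 'rV[R]_m -> R^o) x = dot v (grad f x).
Proof.
move=> df; rewrite deriveE// {1}(row_sum_delta v) linear_sum dotE.
by apply: eq_bigr => j _; rewrite linearZ !mxE deriveE.
Qed.

(** For [0 < t < 1] convexity bounds the difference quotient at [x] along [y - x] by [f y - f x];
    let [t] tend to 0 from the right. *)
Lemma convex_function_grad_le (K : set 'rV[R]_m) (f : 'rV[R]_m -> R) x y :
  convex_function K f -> differentiable (f : 'rV[R]_m -> R^o) x ->
  K x -> K y -> dot (y - x) (grad f x) <= f y - f x.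
Proof.
move=> cf df Kx Ky; rewrite -derive_dot_grad//.
apply: (@cvgr_to_le _ _ _ _ _ _ _ (cvg_dnbhs_at_right (diff_derivable df))).
near=> t; have t0 : 0 < t by near: t; exact: nbhs_right_gt.
have t1 : t < 1 by near: t; exact: nbhs_right_lt.
have := cf (Itv01 (ltW t0) (ltW t1)) y x (mem_set Ky) (mem_set Kx).
rewrite convRE /= /conv /= /unstable.onem => H.
rewrite /GRing.scale /= ler_pdivrMl// lerBlDl.
have -> : t *: (y - x) + x = t *: y + (1 - t) *: x.
  by rewrite scalerBr scalerBl scale1r addrA addrAC.
by apply: le_trans H _; rewrite /=; lra.
Unshelve. all: by end_near. Qed.

End Dot.

Context {Nb : nat} {d : 'I_Nb -> nat}.
Context (X : forall n, set 'rV[R]_(d n)) (f : 'rV[R]_(\sum_n d n) -> R).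
Arguments X n _ : clear implicits.
Implicit Types (x y : 'rV[R]_(\sum_n d n)) (A : {set 'I_Nb}).
Implicit Types (s : forall n, 'rV[R]_(d n)) (gamma : R).

Lemma dot_blocks x y : dot x y = \sum_n dot (submxrow x n) (submxrow y n).
Proof.
rewrite {1}/dot -[x in LHS]submxrowK -[y in LHS]submxrowK tr_mxrow.
by rewrite mul_mxrow_mxcol summxE.
Qed.

Lemma submxrow_block_step A gamma x s n :
  submxrow (block_step A gamma x s) n =
  if n \in A then (1 - gamma) *: submxrow x n + gamma *: s n else submxrow x n.
Proof. by rewrite /block_step mxrowK. Qed.

Lemma block_step_diff A gamma x s n : n \in A ->
  submxrow (block_step A gamma x s) n - submxrow x n
  = gamma *: (s n - submxrow x n).
Proof.
by move=> nA; rewrite submxrow_block_step nA scalerBl scale1r scalerBr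
  addrAC [X in X + _]addrAC subrr add0r addrC.
Qed.

Section Feasibility.
Hypothesis X_convex : forall n, convex_set (X n).

Lemma feasible_block_step A gamma x s : 0 < gamma <= 1 -> feasible X x ->
  (forall n, n \in A -> X n (s n)) -> feasible X (block_step A gamma x s).
Proof.
move=> /andP[g0 g1] Xx Xs n; rewrite submxrow_block_step.
case: ifPn => [nA|_]; last exact: Xx.
have := X_convex (Itv01 (ltW g0) g1) (mem_set (Xs n nA)) (mem_set (Xx n)).
by rewrite inE /conv /= addrC.
Qed.

End Feasibility.

Section Gap.
Hypothesis X_compact : forall n, compact (X n).

(** The contribution of one block to the duality gap: the feasible set is a product, so the linear
    form can be bounded block by block. *)
Definition block_gap x n : R :=
  sup [set dot (submxrow x n - v) (block_grad f x n) | v in X n].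

Lemma dot_le_block_gap x n v : X n v ->
  dot (submxrow x n - v) (block_grad f x n) <= block_gap x n.
Proof.
move=> Xv; apply: ub_le_sup; last by exists v.
exact: compact_dot_has_ubound.
Qed.

Lemma dot_le_sum_block_gap x y : feasible X y ->
  dot (x - y) (grad f x) <= \sum_n block_gap x n.
Proof.
move=> Xy; rewrite dot_blocks; apply: ler_sum => n _.
by rewrite submxrowB dot_le_block_gap.
Qed.

Lemma block_gap_ge0 x n : feasible X x -> 0 <= block_gap x n.
Proof.
by move=> Xx; rewrite (le_trans _ (dot_le_block_gap x (Xx n)))// subrr dot0l.
Qed.

Lemma duality_gap_le x : feasible X x ->
  duality_gap f X x <= \sum_n block_gap x n.
Proof.
move=> Xx; apply: ge_sup => [|_ [y Xy <-]]; last exact: dot_le_sum_block_gap.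
by exists (dot (x - x) (grad f x)); exists x.
Qed.

Lemma duality_gap_ge0 x : feasible X x -> 0 <= duality_gap f X x.
Proof.
move=> Xx; apply: ub_le_sup; last by exists x; rewrite // subrr dot0l.
exists (\sum_n block_gap x n) => _ [y Xy <-]; exact: dot_le_sum_block_gap.
Qed.

End Gap.

Section Curvature.
Hypothesis curvature_finite : set_curvature f X [set: 'I_Nb]%SET \is a fin_num.

Lemma curvature_quotients_subT A :
  curvature_quotients f X A `<=` curvature_quotients f X [set: 'I_Nb]%SET.
Proof.
move=> c [gamma [x [s [g01 Xx Xs ->]]]].
pose s' n := if n \in A then s n else submxrow x n.
have stepE : block_step [set: 'I_Nb]%SET gamma x s' = block_step A gamma x s.
  apply/mxrowP => n; rewrite !submxrow_block_step finset.in_setT /s'.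
  by case: ifP => // _; rewrite -scalerDl subrK scale1r.
exists gamma, x, s'; split=> //= [n _|].
  by rewrite /s'; case: ifP => [|_]; [exact: Xs|exact: Xx].
rewrite stepE; congr (_ * (_ - _ - _)).
rewrite [RHS](bigID (mem A))/= [X in _ = _ + X]big1 ?addr0; last first.
  move=> n /andP[_ nA].
  by rewrite submxrow_block_step (negPf nA) subrr dot0l.
by apply: eq_bigl => n; rewrite finset.in_setT.
Qed.

Lemma set_curvature_fin_num A x : feasible X x ->
  set_curvature f X A \is a fin_num /\ 0 <= fine (set_curvature f X A).
Proof.
move=> Xx.
have ge0 : (0 <= set_curvature f X A)%E.
  apply: ereal_sup_ubound; exists 0 => //.
  (* Moving each block towards itself leaves [x] fixed and realizes the quotient 0. *)
  exists 1, x, (fun n => submxrow x n); split=> //=; first by rewrite ltr01 lexx.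
  have -> : block_step A 1 x (fun n => submxrow x n) = x.
    apply/mxrowP => n; rewrite submxrow_block_step.
    by rewrite subrr scale0r scale1r add0r if_same.
  rewrite subrr sub0r big1 ?oppr0 ?mulr0// => n _.
  by rewrite subrr dot0l.
split; last exact: fine_ge0.
rewrite ge0_fin_numE//.
apply: (@le_lt_trans _ _ (set_curvature f X [set: 'I_Nb]%SET)).
  by apply: ge_ereal_sup => _ [c Ac <-]; apply: ereal_sup_ubound;
    exists c => //; exact: curvature_quotients_subT Ac.
by rewrite ltey_eq curvature_finite.
Qed.

(** The curvature of [A] controls the linearization error, and since each [s n] minimizes the linear
    form over its block, the linear decrease is at least [gamma] times the sum of the block gaps. *)
Lemma block_step_descent A gamma x s : 0 < gamma <= 1 -> feasible X x ->
  (forall n, n \in A -> X n (s n) /\ forall v, X n v ->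
     dot (s n) (block_grad f x n) <= dot v (block_grad f x n)) ->
  f (block_step A gamma x s) + gamma * \sum_(n in A) block_gap x n
    <= f x + gamma ^+ 2 / 2 * fine (set_curvature f X A).
Proof.
move=> /[dup] g01 /andP[g0 g1] Xx hs.
set y := block_step A gamma x s.
have quotient_le : 2 / gamma ^+ 2 * (f y - f x
    - \sum_(n in A) dot (submxrow y n - submxrow x n) (block_grad f x n))
    <= fine (set_curvature f X A).
  rewrite -lee_fin fineK; last by have [] := set_curvature_fin_num A Xx.
  apply: ereal_sup_ubound; eexists; last reflexivity.
  by exists gamma, x, s; split=> // n /hs[].
have gap_le : gamma * \sum_(n in A) block_gap x n <=
    - \sum_(n in A) dot (submxrow y n - submxrow x n) (block_grad f x n).
  rewrite mulr_sumr -sumrN; apply: ler_sum => n nA.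
  rewrite block_step_diff// dotZl -mulrN ler_pM2l// dotBl opprB -dotBl.
  apply: ge_sup.
    by exists (dot (submxrow x n - submxrow x n) (block_grad f x n)), (submxrow x n).
  by move=> _ [v Xv <-]; rewrite !dotBl lerB//; have [_] := hs n nA; exact.
rewrite mulrC -ler_pdivlMr ?divr_gt0 ?exprn_gt0// in quotient_le.
have -> : gamma ^+ 2 / 2 * fine (set_curvature f X A) =
  fine (set_curvature f X A) / (2 / gamma ^+ 2) by rewrite invf_div mulrC.
by lra.
Qed.

End Curvature.

End Blocks.

(** * Inclusion probability of a block in a uniform draw *)

Section UniformSubset.
Context {R : realType}.

(** The draws avoiding [n] are the [B]-subsets of its complement, so Pascal's rule leaves
    ['C(Nb.-1, B.-1)] draws containing [n]; the ratio then follows from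
    [Nb * 'C(Nb.-1, B.-1) = B * 'C(Nb, B)]. *)
Lemma sum_card_draws_mem (Nb B : nat) (n : 'I_Nb) : (1 <= B <= Nb)%N ->
  'C(Nb, B)%:R^-1 * \sum_(A : {set 'I_Nb} | #|A| == B) (n \in A)%:R
  = B%:R / Nb%:R :> R.
Proof.
move=> /andP[B0 BN].
have -> : \sum_(A : {set 'I_Nb} | #|A| == B) (n \in A)%:R
    = 'C(Nb.-1, B.-1)%:R :> R.
  rewrite -natr_sum; congr (_%:R).
  have total : (\sum_(A : {set 'I_Nb} | #|A| == B) (n \in A)
      + \sum_(A : {set 'I_Nb} | #|A| == B) (n \notin A) = 'C(Nb, B))%N.
    rewrite -big_split /= -[in RHS](card_ord Nb) -card_draws -sum1dep_card.
    by rewrite (eq_bigr (fun=> 1%N))// => A _; case: (n \in A).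
  have out : (\sum_(A : {set 'I_Nb} | #|A| == B) (n \notin A) = 'C(Nb.-1, B))%N.
    have <- : #|[set~ n]%SET| = Nb.-1 by rewrite cardsC1 card_ord.
    rewrite -cards_draws -sum1dep_card [RHS]big_mkcond [LHS]big_mkcond /=.
    by apply: eq_bigr => A _; rewrite -finset.setTD
      finset.subsetD1 finset.subsetT; case: (n \in A); case: eqP.
  move: total; rewrite out; case: Nb B n B0 BN {out} => [|N] [|b] // n _ _.
  by rewrite binS /= addnC => /addnI.
have C0 : 'C(Nb, B)%:R != 0 :> R by rewrite pnatr_eq0 -lt0n bin_gt0.
have N0 : Nb%:R != 0 :> R by rewrite pnatr_eq0 -lt0n (leq_trans B0).
have := mul_bin_diag Nb B.-1; rewrite prednK// => /(congr1 (fun k => k%:R : R)).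
rewrite !natrM => E; apply: (mulfI C0); rewrite mulVKf//.
by apply: (mulIf N0); rewrite mulrA divfK// [LHS]mulrC E mulrC.
Qed.

End UniformSubset.

(** * The random iterates and their descent in expectation *)

Section Iterates.
Context (R : realType) (Nb B : nat) (d : 'I_Nb -> nat)
  (hB : (1 <= B <= Nb)%N)
  (X : forall n, set 'rV[R]_(d n)).
Arguments X n _ : clear implicits.
Context (X_convex : forall n, convex_set (X n))
  (X_compact : forall n, compact (X n))
  (f : 'rV[R]_(\sum_n d n) -> R)
  (f_diff : forall x, feasible X x ->
     differentiable (f : 'rV[R]_(\sum_n d n) -> R^o) x)
  (f_convex : convex_function (feasible X) f)
  (curvature_finite : set_curvature f X [set: 'I_Nb]%SET \is a fin_num)
  (xstar : 'rV[R]_(\sum_n d n)) (xstar_feasible : feasible X xstar)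
  (xstar_min : forall y, feasible X y -> f xstar <= f y)
  (gamma : nat -> R) (gamma01 : forall t, 0 < gamma t <= 1)
  (dd : measure_display) (T : measurableType dd) (P : probability T R)
  (D : nat -> T -> {set 'I_Nb}) (hD : independent_uniform_draws P B D)
  (x0 : 'rV[R]_(\sum_n d n)) (x0_feasible : feasible X x0)
  (s : nat -> T -> forall n, 'rV[R]_(d n))
  (x : nat -> T -> 'rV[R]_(\sum_n d n))
  (hx : rbfw_iterates f X gamma D x0 s x).

Let h z := f z - f xstar.
Let G z := \sum_n block_gap X f z n.

Lemma iterates_feasible t w : feasible X (x t w).
Proof.
elim: t => [|t IH]; first by rewrite (iterates_init hx).
rewrite (iterates_step hx); apply: feasible_block_step => // n nA.
by have [] := iterates_oracle hx nA.
Qed.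

(** Ties at iteration [t] may be broken using [D t] itself, but this affects only [x t.+1]; hence
    [x t] depends on earlier draws alone and is independent of [D t]. *)
Lemma iterates_history t : exists psi : seq {set 'I_Nb} -> 'rV[R]_(\sum_n d n),
  forall w, x t w = psi (history D t w).
Proof.
elim: t => [|t [psi IH]].
  by exists (fun=> x0) => w; rewrite (iterates_init hx).
have [phi hphi] := iterates_adapted hx t.
exists (fun l => block_step (nth finset.set0 l t) (gamma t) (psi (take t l)) (phi l)).
move=> w; rewrite (iterates_step hx) IH hphi /history nth_mkseq//.
congr (block_step _ _ (psi _) _).
by rewrite mkseqS -cats1 take_size_cat// size_mkseq.
Qed.

Lemma history_measurable_iterates (F : 'rV[R]_(\sum_n d n) -> R) t :
  history_measurable D t (fun w => F (x t w)).
Proof.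
have [psi hpsi] := iterates_history t; exists (F \o psi).
by apply/funext => w; rewrite hpsi.
Qed.

Let measurable_iterates F t : measurable_fun setT (fun w : T => F (x t w) : R).
Proof.
exact: (measurable_history (draws_measurable hD) (history_measurable_iterates F t)).
Qed.

Lemma expectation_iterates_fin_num F t : (forall z, feasible X z -> 0 <= F z) ->
  'E_P[fun w => F (x t w)]%E \is a fin_num.
Proof.
move=> F0.
apply: (expectation_history_fin_num (draws_measurable hD)
  (draws_independent hD) (history_measurable_iterates F t)).
by move=> w; exact/F0/iterates_feasible.
Qed.

Lemma expectation_draw_mul_iterates t (v : {set 'I_Nb} -> R)
    (F : 'rV[R]_(\sum_n d n) -> R) :
  (forall A, 0 <= v A) -> (forall z, feasible X z -> 0 <= F z) ->
  ('E_P[fun w => v (D t w) * F (x t w)]%R =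
   ('C(Nb, B)%:R^-1 * \sum_(A : {set 'I_Nb} | #|A| == B) v A)%:E
     * 'E_P[fun w => F (x t w)])%E.
Proof.
move=> v0 F0.
rewrite (expectation_draw_mul_history (draws_measurable hD)
  (draws_independent hD) _ (history_measurable_iterates F t))//; last first.
  by move=> w; exact/F0/iterates_feasible.
congr (_ * _)%E; rewrite mulr_sumr -sumEFin [RHS]big_mkcond /=.
apply: eq_bigr => A _; rewrite (draws_uniform hD).
by case: ifP; rewrite ?mul0e// EFinM.
Qed.

Lemma suboptimality_ge0 z : feasible X z -> 0 <= h z.
Proof. by move=> Xz; rewrite subr_ge0; exact: xstar_min. Qed.

(** Test the gap against [xstar] and apply the first-order inequality of convexity. *)
Lemma suboptimality_le_gap z : feasible X z -> h z <= G z.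
Proof.
move=> Xz; apply: le_trans (_ : _ <= dot (z - xstar) (grad f z)) _; last first.
  exact: dot_le_sum_block_gap.
have := convex_function_grad_le f_convex (f_diff Xz) Xz xstar_feasible.
by rewrite !dotBl /h; lra.
Qed.

Lemma sum_block_gap_ge0 z : feasible X z -> 0 <= G z.
Proof. by move=> Xz; apply: sumr_ge0 => n _; exact: block_gap_ge0. Qed.

Lemma expected_curvature_ge0 : 0 <= expected_curvature f X B.
Proof.
rewrite mulr_ge0 ?invr_ge0//; apply: sumr_ge0 => A _.
by have [] := set_curvature_fin_num curvature_finite A x0_feasible.
Qed.

Lemma expected_descent t :
  fine 'E_P[fun w => h (x t.+1 w)]
    + B%:R / Nb%:R * gamma t * fine 'E_P[fun w => G (x t w)]
  <= fine 'E_P[fun w => h (x t w)]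
    + gamma t ^+ 2 / 2 * expected_curvature f X B.
Proof.
have g0 : 0 <= gamma t by case/andP: (gamma01 t) => /ltW.
have h0 k w : 0 <= h (x k w) by exact/suboptimality_ge0/iterates_feasible.
have C0 A : 0 <= fine (set_curvature f X A).
  by have [] := set_curvature_fin_num curvature_finite A x0_feasible.
pose gap n z := block_gap X f z n.
have gap0 n z : feasible X z -> 0 <= gap n z by exact: block_gap_ge0.
pose mem n (A : {set 'I_Nb}) : R := (n \in A)%:R.
have mG n : measurable_fun setT (fun w => mem n (D t w) * gap n (x t w)).
  apply: measurable_funM (measurable_iterates (gap n) t).
  exact: measurable_draw (draws_measurable hD) _ _.
have mG0 n w : 0 <= mem n (D t w) * gap n (x t w).
  by rewrite mulr_ge0// gap0//; exact: iterates_feasible.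
have EG : ('E_P[fun w => \sum_n mem n (D t w) * gap n (x t w)]%R
    = (B%:R / Nb%:R)%:E * 'E_P[fun w => G (x t w)])%E.
  rewrite ge0_expectation_sum// [in RHS]ge0_expectation_sum//; last 2 first.
  - by move=> n; exact: measurable_iterates (gap n) t.
  - by move=> n w; exact/gap0/iterates_feasible.
  rewrite ge0_sume_distrr; last first.
    by move=> n _; apply: expectation_ge0 => w; exact/gap0/iterates_feasible.
  apply: eq_bigr => n _; rewrite expectation_draw_mul_iterates//; last exact: gap0.
  by rewrite sum_card_draws_mem.
have EC : ('E_P[fun w => fine (set_curvature f X (D t w))]
    = (expected_curvature f X B)%:E)%E.
  (* The factor 1, seen as a constant function of the iterate, brings this into the form of
     [expectation_draw_mul_iterates]. *)
  have -> : (fun w => fine (set_curvature f X (D t w))) =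
      (fun w => fine (set_curvature f X (D t w)) * cst 1 (x t w)).
    by apply/funext => w; rewrite mulr1.
  rewrite (expectation_draw_mul_iterates t (F := cst 1) C0)//.
  by rewrite (expectation_cst P 1) mule1.
have mC : measurable_fun setT (fun w => fine (set_curvature f X (D t w))).
  exact: (measurable_draw (draws_measurable hD) t (fun A => fine (set_curvature f X A))).
have msum : measurable_fun setT (fun w => \sum_n mem n (D t w) * gap n (x t w)).
  exact: measurable_sum.
have sum0 w : 0 <= \sum_n mem n (D t w) * gap n (x t w) by exact: sumr_ge0.
have half0 : 0 <= gamma t ^+ 2 / 2 by rewrite divr_ge0// sqr_ge0.
(* With the gap kept on the left every term is nonnegative, so the expectations can be combined in
   the extended reals; finiteness then allows the return to real numbers. *)
suff : ('E_P[fun w => h (x t.+1 w)]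
      + (gamma t)%:E * ((B%:R / Nb%:R)%:E * 'E_P[fun w => G (x t w)])
    <= 'E_P[fun w => h (x t w)]
      + (gamma t ^+ 2 / 2)%:E * (expected_curvature f X B)%:E)%E.
  rewrite -(fineK (expectation_iterates_fin_num t.+1 suboptimality_ge0)).
  rewrite -(fineK (expectation_iterates_fin_num t suboptimality_ge0)).
  rewrite -(fineK (expectation_iterates_fin_num t sum_block_gap_ge0)).
  by rewrite -!EFinM -!EFinD lee_fin mulrA [gamma t * _]mulrC.
have mgsum : measurable_fun setT
    (fun w => gamma t * \sum_n mem n (D t w) * gap n (x t w)).
  exact: measurable_funM (measurable_cst _) msum.
have mgC : measurable_fun setT
    (fun w => gamma t ^+ 2 / 2 * fine (set_curvature f X (D t w))).
  exact: measurable_funM (measurable_cst _) mC.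
have mh k : measurable_fun setT (fun w => h (x k w)).
  exact: measurable_iterates h k.
have gsum0 w : 0 <= gamma t * \sum_n mem n (D t w) * gap n (x t w).
  exact: mulr_ge0.
have gC0 w : 0 <= gamma t ^+ 2 / 2 * fine (set_curvature f X (D t w)).
  exact: mulr_ge0.
rewrite -EG -EC -!ge0_expectationZl// -!ge0_expectationD//.
apply: expectation_le.
- exact: measurable_funD (mh t.+1) mgsum.
- exact: measurable_funD (mh t) mgC.
- by move=> w; rewrite addr_ge0.
- by move=> w; rewrite addr_ge0.
apply: aeW => w.
have := block_step_descent curvature_finite (gamma01 t)
  (iterates_feasible t w) (fun n nA => iterates_oracle hx nA).
rewrite -(iterates_step hx) big_mkcond /=.
rewrite (eq_bigr (fun n => mem n (D t w) * gap n (x t w))); first by rewrite /h; lra.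
by move=> n _; rewrite /mem; case: ifP; rewrite ?mul1r ?mul0r.
Qed.

Lemma expected_suboptimality_le_gap t :
  fine 'E_P[fun w => h (x t w)] <= fine 'E_P[fun w => G (x t w)].
Proof.
rewrite fine_le//.
- exact: expectation_iterates_fin_num suboptimality_ge0.
- exact: expectation_iterates_fin_num sum_block_gap_ge0.
apply: expectation_le.
- exact: measurable_iterates h t.
- exact: measurable_iterates G t.
- by move=> w; exact/suboptimality_ge0/iterates_feasible.
- by move=> w; exact/sum_block_gap_ge0/iterates_feasible.
by apply: aeW => w; exact/suboptimality_le_gap/iterates_feasible.
Qed.

Lemma expected_duality_gap_le t :
  ('E_P[fun w => duality_gap f X (x t w)] <=
   (fine 'E_P[fun w => G (x t w)])%:E)%E.
Proof.
rewrite fineK; last exact: expectation_iterates_fin_num sum_block_gap_ge0.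
apply: expectation_le.
- exact: measurable_iterates (duality_gap f X) t.
- exact: measurable_iterates G t.
- by move=> w; exact/duality_gap_ge0/iterates_feasible.
- by move=> w; exact/sum_block_gap_ge0/iterates_feasible.
by apply: aeW => w; exact/duality_gap_le/iterates_feasible.
Qed.

End Iterates.

(** * The convergence rates for the given step sizes *)

Theorem corollary1 (R : realType) (Nb B : nat) (d : 'I_Nb -> nat)
  (hNb : (1 <= Nb)%N) (hB : (1 <= B <= Nb)%N)
  (X : forall n, set 'rV[R]_(d n))
  (X_nonempty : forall n, X n !=set0)
  (X_convex : forall n, convex_set (X n))
  (X_compact : forall n, compact (X n))
  (f : 'rV[R]_(\sum_n d n) -> R)
  (f_diff : exists U : set 'rV[R]_(\sum_n d n),
     [/\ open U, feasible X `<=` U &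
         forall x, U x -> differentiable (f : 'rV[R]_(\sum_n d n) -> R^o) x])
  (f_convex : convex_function (feasible X) f)
  (curvature_finite : set_curvature f X [set: 'I_Nb]%SET \is a fin_num)
  (xstar : 'rV[R]_(\sum_n d n)) (xstar_feasible : feasible X xstar)
  (xstar_min : forall y, feasible X y -> f xstar <= f y)
  (q rho : R) (hq : 0 < q <= B%:R / Nb%:R) (hrho : 1 / 2 < rho <= 1)
  (dd : measure_display) (T : measurableType dd) (P : probability T R)
  (D : nat -> T -> {set 'I_Nb}) (hD : independent_uniform_draws P B D)
  (x0 : 'rV[R]_(\sum_n d n)) (x0_feasible : feasible X x0)
  (s : nat -> T -> forall n, 'rV[R]_(d n))
  (x : nat -> T -> 'rV[R]_(\sum_n d n))
  (hx : rbfw_iterates f X (fun t => 2 / (q * t%:R `^ rho + 2)) D x0 s x) :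
  let alpha : R := B%:R / Nb%:R in
  let h := fun z => f z - f xstar in
  let Cbar := expected_curvature f X B in
  forall t : nat, (1 <= t)%N ->
    ('E_P[fun w => h (x t w)] <=
       (4 * (1 - alpha) * h x0 / (q * (t%:R - 1) `^ rho + 2) ^+ 2
        + 2 * t%:R * Cbar / (q * (t%:R - 1) `^ rho + 2) ^+ 2)%:E)%E
    /\
    (\big[Order.min/+oo]_(k < t.+1) 'E_P[fun w => duality_gap f X (x k w)] <=
       ((2 * rho + 1) `^ (2 * rho + 1) * (q * t%:R `^ rho + 2)
          / (alpha * q ^+ 2 * (2 * rho) `^ (2 * rho))
        * (((t%:R + 1) * Cbar + 2 * (1 - alpha) * h x0)
             / t%:R `^ (2 * rho + 1)))%:E)%E.
Proof.
move=> alpha h Cbar.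
case: f_diff => U [_ XU dU].
have f_diffX z : feasible X z -> differentiable (f : 'rV_(\sum_n d n) -> R^o) z.
  by move=> /XU/dU.
have /andP[q0 qa] := hq.
have /andP[rho_half rho1] := hrho.
have rho0 : 0 < rho by lra.
have Nb0 : 0 < Nb%:R :> R by rewrite ltr0n.
have alpha1 : alpha <= 1.
  by rewrite ler_pdivrMr// mul1r ler_nat; case/andP: hB.
pose a (t : nat) : R := q * t%:R `^ rho + 2.
(* Here [0 ^ rho = 0], because [rho] is positive; the first step is a full one. *)
have a0 : a 0%N = 2 by rewrite /a powR0 ?gt_eqF// mulr0 add0r.
have a_ge2 t : 2 <= a t by rewrite lerDr mulr_ge0 ?powR_ge0// ltW.
have a_mono t : a t <= a t.+1 <= a t + q.
  have := @powR_add1_le R rho t%:R; rewrite rho0 rho1 natr1 => /(_ isT (ler0n _ _)).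
  have : t%:R `^ rho <= t.+1%:R `^ rho :> R.
    by apply: ge0_ler_powR; rewrite ?nnegrE ?ler_nat// ltW.
  by rewrite /a; nra.
have gamma01 t : 0 < 2 / a t <= 1.
  have at0 : 0 < a t by apply: lt_le_trans (a_ge2 t).
  by rewrite divr_gt0//= ler_pdivrMr// mul1r.
pose eh t := fine 'E_P[fun w => h (x t w)].
pose eg t := fine 'E_P[fun w => \sum_n block_gap X f (x t w) n].
have h_ge0 z : feasible X z -> 0 <= h z by exact: suboptimality_ge0.
have ehE t : ('E_P[fun w => h (x t w)] = (eh t)%:E)%E.
  by rewrite fineK// (expectation_iterates_fin_num X_convex gamma01 hD x0_feasible hx).
have eh_ge0 t : 0 <= eh t.
  rewrite -lee_fin -ehE expectation_ge0// => w.
  exact/h_ge0/(iterates_feasible X_convex gamma01 x0_feasible hx).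
have eh0 : eh 0%N = h x0.
  rewrite /eh (_ : (fun w => _) = cst (h x0)) ?expectation_cst//.
  by apply/funext => w; rewrite (iterates_init hx).
have eh_eg t : eh t <= eg t.
  exact: (expected_suboptimality_le_gap X_convex X_compact f_diffX f_convex
    xstar_feasible xstar_min gamma01 hD x0_feasible hx).
have C_ge0 : 0 <= Cbar by exact: (expected_curvature_ge0 _ curvature_finite x0_feasible).
have rec t : eh t.+1 + alpha * (2 / a t) * eg t
    <= eh t + (2 / a t) ^+ 2 / 2 * Cbar.
  exact: (expected_descent hB X_convex X_compact curvature_finite
    xstar_min gamma01 hD x0_feasible hx).
(* With the time written as [t.+1], the [t - 1] of the first bound is the index of the last step
   size used. *)
move=> [|t] // _; split.
  have -> : t.+1%:R - 1 = t%:R :> R by rewrite -(natr1 t) addrK.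
  rewrite ehE lee_fin -/(a t) -mulrDl -eh0.
  exact: (recursion_primal_bound hq alpha1 C_ge0 a0 a_ge2 a_mono eh_ge0 eh_eg rec).
have [||j jt peak] := @exists_averaging_start R q rho t.+1 _ hrho.
- by rewrite q0 (le_trans qa).
- by [].
have [k kt eg_le] := recursion_dual_bound hq alpha1 C_ge0 a0 a_ge2 a_mono
  eh_ge0 eh_eg rec jt.
apply: (@bigmin_inf _ _ _ _ (Ordinal (kt : (k < t.+2)%N))) => //=.
apply: le_trans (_ : _ <= (eg k)%:E)%E _.
  exact: (expected_duality_gap_le X_convex X_compact gamma01 hD x0_feasible hx).
rewrite lee_fin (le_trans eg_le)// eh0 -/(a t.+1).
have alpha0 : 0 < alpha by exact: lt_le_trans qa.
have t0 : 0 < t.+1%:R :> R by rewrite ltr0n.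
have r2 : 0 < 2 * rho by lra.
have r21 : 0 < 2 * rho + 1 by lra.
set M := (t.+1%:R + 1) * Cbar + _.
have M0 : 0 <= M.
  apply: addr_ge0; first by rewrite mulr_ge0// addr_ge0.
  by apply: mulr_ge0; [rewrite mulr_ge0// subr_ge0|exact: h_ge0].
(* [c] is the maximum over [u] of [(t.+1 - u) * u ^ (2 * rho)]; the claimed bound has denominator
   [alpha * (q ^+ 2 * c)], which [peak] compares with that of [eg_le]. *)
set c := _ / _ * _ in peak.
have c0 : 0 < c by rewrite !mulr_gt0 ?invr_gt0 ?powR_gt0.
have -> : (2 * rho + 1) `^ (2 * rho + 1) * a t.+1 /
    (alpha * q ^+ 2 * (2 * rho) `^ (2 * rho)) * (M / t.+1%:R `^ (2 * rho + 1))
    = a t.+1 * M / (alpha * (q ^+ 2 * c)).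
  rewrite /c; field.
  by rewrite !gt_eqF ?powR_gt0.
have lb0 : 0 < alpha * (q ^+ 2 * c).
  by apply: mulr_gt0 => //; apply: mulr_gt0 => //; exact: exprn_gt0.
rewrite ler_wpM2l ?mulr_ge0 ?(le_trans _ (a_ge2 _))//.
have le_den : alpha * (q ^+ 2 * c) <= alpha * (t.+1%:R - j%:R) * a j ^+ 2.
  by rewrite -mulrA ler_pM2l.
rewrite lef_pV2// posrE; exact: lt_le_trans le_den.
Qed.
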